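(* Let $H\in(\frac12,1)$, let $\theta\in(0,1)$, and let $\xi=(\xi_t)_{t\in\mathbb Z}$ be a centered stationary Gaussian sequence satisfying the Hypothesis stated in the context with this $H$. Let $X_0=0$, $X_t=\theta X_{t-1}+\xi_t$ for $t\ge1$, and let $\tilde\theta_n=f^{-1}\big(\frac1n\sum_{t=1}^nX_t^2\big)$ be the second moment estimator of $\theta$, with $f$ as in the context. Then $\tilde\theta_n$ is strongly consistent, i.e. $\lim_{n\to\infty}\tilde\theta_n=\theta$ almost surely.
   Context: **Slow variation.** A positive function $L$ defined for $x>x_0$ is slowly varying at infinity in Zygmund's sense if for every $\delta>0$, $x^{\delta}L(x)$ is increasing and $x^{-\delta}L(x)$ is decreasing for $x$ large enough. **Hypothesis (on $\xi$).** $\xi=(\xi_t)_{t\in\mathbb Z}$ is a centered stationary Gaussian sequence whose covariance function $\rho(k)=\mathbb E(\xi_0\xi_k)$ satisfies $\rho(0)=1$ and $\rho(k)=L(|k|)\,|k|^{2H-2}$ for $k\in\mathbb Z\setminus\{0\}$, where $H\in(\frac12,1)$, $L:(0,\infty)\to(0,\infty)$ is slowly varying at infinity in Zygmund's sense, and $\lambda\mapsto L(1/\lambda)$ is of bounded variation on $(a,\pi)$ for every $a>0$. **Function $f$.** For $\vartheta\in(0,1)$, $f(\vartheta)=\sum_{i,j=0}^\infty\vartheta^{i+j}\rho(i-j)$; it equals $\mathbb E(Y_t^2)$ for the stationary solution $Y_t=\sum_{j\ge0}\vartheta^j\xi_{t-j}$ of the autoregression with parameter $\vartheta$. It is positive and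 strictly increasing on $(0,1)$, and $f^{-1}$ denotes its inverse function. Almost surely, $\frac1n\sum_{t=1}^nX_t^2$ belongs to the range of $f$ when $n$ is large enough, so that then $\tilde\theta_n\in(0,1)$. *)

(* Defs.v *)
From HB Require Import structures.
From mathcomp Require Import all_boot all_order all_algebra.
From mathcomp Require Import all_classical all_reals all_analysis.

Set Implicit Arguments.
Unset Strict Implicit.
Unset Printing Implicit Defensive.

Import Order.TTheory GRing.Theory Num.Theory.
Import numFieldNormedType.Exports.

Local Open Scope classical_set_scope.
Local Open Scope ring_scope.

Section slow_variation.
Context {R : realType}.
Implicit Types (L g : R -> R).

(* Monotonicity is meant in the wide sense. Since [L] is positive and every
   [delta > 0] is considered, the strict reading defines the same class. *)
Definition zygmund_slowly_varying L : Prop :=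
  forall delta : R, 0 < delta -> exists M : R, 0 < M /\
    forall x y : R, M < x -> x <= y ->
      x `^ delta * L x <= y `^ delta * L y /\
      y `^ (- delta) * L y <= x `^ (- delta) * L x.

(* The library's [bounded_variation] is about closed intervals. On the open
   interval (a, b) the variations along all finite increasing sequences of
   points of (a, b) must have a common bound. *)
Definition bounded_variation_oo (a b : R) g : Prop :=
  exists M : R, forall c d : R, a < c -> c <= d -> d < b ->
    ubound (variations c d g) M.

End slow_variation.

Section gaussian_sequences.
Context {d : measure_display} {T : measurableType d} {R : realType}.
Variable P : probability T R.

(* The degenerate case is separate because the library's [normal_prob m 0] is
   not the Dirac mass at [m]. Otherwise [s] is the standard deviation. *)
Definition gaussian_law (X : T -> R) : Prop :=
  exists m s : R, 0 <= s /\
    forall A : set R, measurable A ->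
      P (X @^-1` A) = if s == 0 then \d_m A else normal_prob m s A.

Variable xi : int -> {RV P >-> R}.

Definition gaussian_sequence : Prop :=
  forall (n : nat) (t : 'I_n -> int) (c : 'I_n -> R),
    gaussian_law (fun w => \sum_(i < n) c i * xi (t i) w).

Definition centered_sequence : Prop := forall t : int, ('E_P[xi t] = 0)%E.

Definition stationary_sequence : Prop :=
  forall (n : nat) (t : 'I_n -> int) (h : int) (A : set (n.-tuple R)),
    measurable A ->
    P [set w | A [tuple xi (t i + h) w | i < n]] =
    P [set w | A [tuple xi (t i) w | i < n]].

(* [fine] loses nothing for a Gaussian sequence, whose moments are finite. *)
Definition autocovariance (k : int) : R := fine ('E_P[xi 0%R \* xi k])%E.

End gaussian_sequences.

Section autoregression.
Context {d : measure_display} {T : measurableType d} {R : realType}.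
Variable P : probability T R.

Fixpoint ar1 (xi : int -> {RV P >-> R}) (theta : R) (t : nat) (w : T) : R :=
  if t is s.+1 then theta * ar1 xi theta s w + xi (Posz s.+1) w else 0.

Definition second_moment (xi : int -> {RV P >-> R}) (theta : R) (n : nat)
    (w : T) : R :=
  n%:R^-1 * \sum_(1 <= t < n.+1) (ar1 xi theta t w) ^+ 2.

(* The double series converges absolutely for [v] in (0, 1) and bounded [rho],
   so summing it row by row fixes no particular order of summation. *)
Definition stationary_variance (rho : int -> R) (v : R) : R :=
  limn [series
    limn [series v ^+ (i + j)%N * rho (i%:Z - j%:Z)]_j]_i.

(* [dflt] gives the values of the inverse function outside its domain, the
   range of [stationary_variance rho] on (0, 1), where the estimator is not
   defined mathematically. *)
Definition second_moment_estimator (dflt : R -> R) (xi : int -> {RV P >-> R})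
    (theta : R) (n : nat) (w : T) : R :=
  'pinv_dflt `]0, 1[%classic (stationary_variance (autocovariance xi))
    (second_moment xi theta n w).

End autoregression.

(* Main.v *)
(* For a centered stationary Gaussian sequence, Isserlis' formula gives
   Var (sum_(t <= n) X_t^2) = 2 sum_(s, t <= n) Cov(X_s, X_t)^2. The covariances
   of xi are nonnegative and bounded, so are those of X; hence this is at most a
   constant times sum_(s, t <= n) Cov(X_s, X_t), which the autoregression bounds
   by a constant times sum_(s, t <= n) rho(s - t). Slow variation makes
   rho(k) = O(k^(H - 1)), so the variance of the empirical second moment decays
   like a power of n and is summable along n = N^(2 q). This gives almost sure
   convergence to f(theta) along these n, and along all n because
   sum_(t <= n) X_t^2 is nondecreasing in n and (N + 1)^(2 q) / N^(2 q) -> 1.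
   Finally f is continuous and strictly increasing on (0, 1), hence so is its
   inverse on the range of f. *)

Require Import Defs.
From HB Require Import structures.
From mathcomp Require Import all_boot all_order all_algebra.
From mathcomp Require Import all_classical all_reals all_analysis.
From mathcomp Require Import measurable_realfun zify ring lra.

Import Order.TTheory GRing.Theory Num.Theory.
Import numFieldNormedType.Exports.

Local Open Scope classical_set_scope.
Local Open Scope ring_scope.

(** * Integrals with prescribed real values *)

Section integral_values.
Context {d : measure_display} {T : measurableType d} {R : realType}.
Implicit Types (mu : {measure set T -> \bar R}) (f g : T -> R) (a b : R).

(** Integrability and value travel together, so that linearity applies without side conditions and
    all values stay real. *)
Definition has_integral mu f a : Prop :=
  mu.-integrable setT (EFin \o f) /\ (\int[mu]_x (f x)%:E)%E = a%:E.

Lemma has_integral_unique mu f a b :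
  has_integral mu f a -> has_integral mu f b -> a = b.
Proof. by move=> [_ fa] [_ fb]; apply: EFin_inj; rewrite -fa -fb. Qed.

Lemma has_integral_integrable mu f :
  mu.-integrable setT (EFin \o f) ->
  has_integral mu f (fine (\int[mu]_x (f x)%:E)%E).
Proof. by move=> fi; split=> //; rewrite fineK// integrable_fin_num. Qed.

Lemma has_integralD mu f g a b : has_integral mu f a -> has_integral mu g b ->
  has_integral mu (fun x => f x + g x) (a + b).
Proof.
move=> [fi fa] [gi gb]; split; first exact: (integrableD measurableT fi gi).
under eq_integral do rewrite EFinD.
by rewrite integralD// fa gb.
Qed.

Lemma has_integralZ mu f a k : has_integral mu f a ->
  has_integral mu (fun x => k * f x) (k * a).
Proof.
move=> [fi fa]; split; first exact: (integrableZl measurableT k fi).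
under eq_integral do rewrite EFinM.
by rewrite integralZl// fa.
Qed.

Lemma has_integralB mu f g a b : has_integral mu f a -> has_integral mu g b ->
  has_integral mu (fun x => f x - g x) (a - b).
Proof.
move=> fa /(has_integralZ _ _ _ (- 1)) gb; have := has_integralD _ _ _ _ _ fa gb.
by rewrite mulN1r; under eq_fun do rewrite mulN1r.
Qed.

Lemma has_integral0 mu : has_integral mu (fun=> 0) 0.
Proof. by split; [exact: integrable0|rewrite integral0]. Qed.

Lemma has_integral_sum mu (I : Type) (r : seq I) (F : I -> T -> R) (A : I -> R) :
  (forall i, has_integral mu (F i) (A i)) ->
  has_integral mu (fun x => \sum_(i <- r) F i x) (\sum_(i <- r) A i).
Proof.
move=> FA; elim: r => [|i r IH].
  by rewrite big_nil; under eq_fun do rewrite big_nil; exact: has_integral0.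
by rewrite big_cons; under eq_fun do rewrite big_cons; exact: has_integralD.
Qed.

Lemma has_integral_cst (P : probability T R) c : has_integral P (fun=> c) c.
Proof.
split; first exact: finite_measure_integrable_cst.
by rewrite integral_cst//= probability_setT mule1.
Qed.

End integral_values.

Section transfer.
Context {d : measure_display} {T : measurableType d} {R : realType}.
Variable mu : {measure set T -> \bar R}.

(** The values on measurable sets identify [nu] with the pushforward of [mu]. The nonnegative change
    of variables, applied to the absolute value of [g], gives integrability; then the signed one
    applies. *)
Lemma has_integral_law {d'} {U : measurableType d'} (X : T -> U)
    (nu : {measure set U -> \bar R}) (g : U -> R) (a : R) :
  measurable_fun setT X ->
  (forall A, measurable A -> mu (X @^-1` A) = nu A) ->
  has_integral nu g a -> has_integral mu (fun w => g (X w)) a.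
Proof.
move=> mX muX [gi ga].
have mg : measurable_fun setT g by apply/measurable_EFinP/(measurable_int _ gi).
have mgX : measurable_fun setT (fun w => g (X w)) by exact: measurableT_comp.
have nuE : forall A, measurable A -> A `<=` setT -> nu A = pushforward mu X A.
  by move=> A mA _; rewrite -muX.
have Xi : mu.-integrable setT (EFin \o (fun w => g (X w))).
  apply/integrableP; split; first exact/measurable_EFinP.
  have /integrableP[_] := gi.
  rewrite (eq_measure_integral _ nuE) ge0_integral_pushforward//.
  by apply: measurableT_comp => //; exact/measurable_EFinP.
split=> //; rewrite -ga (eq_measure_integral _ nuE).
by rewrite [RHS]integral_pushforward//; exact/measurable_EFinP.
Qed.

End transfer.

(** * Moments of the normal distribution *)

Section normal_moments.
Context {R : realType}.
Implicit Types (m s x : R) (k : nat).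
Local Notation leb := (@lebesgue_measure R).

(** For positive [k] the Taylor term [(a q)^k / k!] is at most [exp (a q)]. *)
Lemma exprn_mul_expRN_le k (a : R) : 0 < a ->
  exists2 C, 0 <= C & forall q : R, 0 <= q -> q ^+ k * expR (- (a * q)) <= C.
Proof.
move=> a0; case: k => [|k].
  exists 1 => // q q0; rewrite expr0 mul1r expR_le1 oppr_le0.
  by rewrite mulr_ge0// ltW.
exists (k.+1`!%:R / a ^+ k.+1) => [|q q0].
  by rewrite divr_ge0// exprn_ge0// ltW.
have aq0 : 0 <= a * q by rewrite mulr_ge0// ltW.
rewrite expRN ler_pdivrMr ?expR_gt0// mulrAC ler_pdivlMr ?exprn_gt0//.
have := expR_ge1Dxn k aq0.
rewrite exprMn => h.
have f0 : 0 < (k.+1`!%:R : R) by rewrite ltr0n fact_gt0.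
have : a ^+ k.+1 * q ^+ k.+1 / k.+1`!%:R <= expR (a * q).
  by apply: le_trans h; rewrite lerDr.
by rewrite ler_pdivrMr// mulrC [X in _ <= X]mulrC.
Qed.

(* Three quarters of the exponent absorb the power, and what is left is the
   density for twice the standard deviation. *)
Lemma normal_moment_le m s k : s != 0 ->
  exists2 C, 0 <= C & forall x,
    `|(x - m) ^+ k * normal_pdf m s x| <= C * normal_pdf m (2 * s) x.
Proof.
move=> s0; have s20 : 2 * s != 0 by rewrite mulf_neq0// pnatr_eq0.
have [C C0 hC] := exprn_mul_expRN_le k (3 / 4) ltac:(lra).
have [C' C'0 hC'] := exprn_mul_expRN_le 0 (3 / 4) ltac:(lra).
have ss : 0 < s ^+ 2 by rewrite exprn_even_gt0.
(* The two summands serve the two terms of [|u ^ k| <= u ^ (2 k) + 1], an estimate that treats odd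
   and even [k] alike. *)
pose D := (s ^+ 2 *+ 2) ^+ k * C + C'.
have D0 : 0 <= D by rewrite addr_ge0// mulr_ge0// exprn_ge0// mulrn_wge0// ltW.
have p2 := normal_peak_gt0 s20.
exists (normal_peak s * D / normal_peak (2 * s)) => [|x].
  by rewrite divr_ge0 ?mulr_ge0 ?normal_peak_ge0// ltW.
rewrite !normal_pdfE// [leRHS]mulrA divfK ?gt_eqF// -!mulrA.
rewrite normrM (ger0_norm (mulr_ge0 (normal_peak_ge0 _) (normal_fun_ge0 _ _ _))).
rewrite mulrCA ler_wpM2l ?normal_peak_ge0//.
set u := x - m; pose q := u ^+ 2 / (s ^+ 2 *+ 2).
have q0 : 0 <= q by rewrite divr_ge0 ?sqr_ge0// mulrn_wge0// ltW.
have -> : normal_fun m s x = expR (- (3 / 4 * q)) * normal_fun m (2 * s) x.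
  rewrite /normal_fun -expRD; congr expR; rewrite -/u /q.
  by field.
rewrite mulrA ler_wpM2r ?normal_fun_ge0//.
have uk : `|u ^+ k| <= u ^+ 2 ^+ k + 1.
  rewrite -exprM mulnC exprM -(real_normK (num_real (u ^+ k))).
  by have := normr_ge0 (u ^+ k); nra.
apply: (le_trans (ler_wpM2r (expR_ge0 _) uk)).
rewrite mulrDl; apply: lerD; last by have := hC' q q0; rewrite expr0.
have -> : u ^+ 2 = (s ^+ 2 *+ 2) * q.
  by rewrite /q mulrC divfK// mulrn_eq0/= sqrf_eq0.
rewrite exprMn -[leLHS]mulrA ler_wpM2l ?hC//.
by rewrite exprn_ge0// mulrn_wge0// ltW.
Qed.

Lemma measurable_normal_moment m s k :
  measurable_fun setT (fun x => (x - m) ^+ k * normal_pdf m s x).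
Proof.
apply: measurable_funM; last exact: measurable_normal_pdf.
by apply: measurable_funX; exact: measurable_funB.
Qed.

Lemma integrable_normal_moment m s k : s != 0 ->
  leb.-integrable setT (EFin \o (fun x => (x - m) ^+ k * normal_pdf m s x)).
Proof.
move=> s0; have [C C0 hC] := normal_moment_le m s k s0.
apply: (@le_integrable _ _ _ leb setT measurableT _
  (EFin \o (fun x => C * normal_pdf m (2 * s) x))).
- by apply/measurable_EFinP; exact: measurable_normal_moment.
- move=> x _ /=; rewrite lee_fin (le_trans (hC x))// ler_norm//.
- exact: (integrableZl measurableT C (integrable_normal_pdf m (2 * s))).
Qed.

(** The density has derivative [- (x - m) / s ^ 2] times itself, so the product rule yields the
    orders [k - 1] and [k + 1]. At [k = 0] the factor [k%:R] removes the truncated predecessor. *)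
Lemma is_derive_normal_moment m s k x : s != 0 ->
  is_derive x 1 (fun y => (y - m) ^+ k * normal_pdf m s y)
    (k%:R * ((x - m) ^+ k.-1 * normal_pdf m s x)
     - (s ^+ 2)^-1 * ((x - m) ^+ k.+1 * normal_pdf m s x)).
Proof.
move=> s0.
have -> : normal_pdf m s =
    (fun y => normal_peak s * expR ((- (s ^+ 2 *+ 2)^-1) * (y - m) ^+ 2)).
  by apply/funext => y; rewrite normal_pdfE//; congr (_ * expR _); rewrite !mulNr mulrC.
have du : is_derive x 1 (fun y : R => y - m) (1 - 0).
  exact: (is_deriveB (is_derive_id x 1) (is_derive_cst m x 1)).
have duX j : is_derive x 1 (fun y : R => (y - m) ^+ j) (j%:R * (x - m) ^+ j.-1).
  have := @is_deriveX _ _ _ j x 1 _ du; rewrite /GRing.scale/= subr0 mulr1.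
  by congr (is_derive _ _ _ _); apply/funext => y; rewrite exprfctE.
have dexp := @is_derive1_comp _ expR _ x _ _ (is_derive_expR _)
  (is_deriveZ (- (s ^+ 2 *+ 2)^-1) (duX 2%N)).
apply: (is_derive_eq (is_deriveM (duX k) (is_deriveZ (normal_peak s) dexp))).
rewrite /GRing.scale /= /GRing.scale /= expr1.
set e := expR _; set p := normal_peak s; set u := x - m. rewrite [u ^+ k.+1]exprS.
by field.
Qed.

(** The integral over [[m - (n + 1), m + (n + 1)]] is an increment of [F]; dominated convergence,
    with the absolute value of [f] as bound, identifies the limit of these integrals with the
    integral over the line. *)
Lemma has_integral_derive0 (F f : R -> R) m :
  (forall x, is_derive x 1 F (f x)) -> continuous f ->
  leb.-integrable setT (EFin \o f) ->
  F (m + n.+1%:R) - F (m - n.+1%:R) @[n --> \oo] --> (0 : R) ->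
  has_integral leb f 0.
Proof.
move=> dF cf fi F0; split=> //.
pose I n : set R := `[m - n.+1%:R, m + n.+1%:R]%classic.
pose f_ n := (EFin \o f) \_ (I n).
have mf : measurable_fun setT (EFin \o f) := measurable_int _ fi.
have cF : continuous F.
  by move=> x; apply/differentiable_continuous/derivable1_diffP; exact: ex_derive.
have [|||||_ _] := @dominated_convergence _ _ _ leb setT measurableT f_
  (EFin \o f) (abse \o (EFin \o f)).
- move=> n; have mI : measurable (I n) by exact: measurable_itv.
  by have /(measurable_restrictT _ mI) : measurable_fun (I n) (EFin \o f) by
    exact: measurable_funTS.
- exact: mf.
- apply/aeW => x _; apply: cvg_near_cst; near=> n.
  rewrite /f_ patchE ifT// inE /I/= in_itv/=.
  have xn : `|x - m| <= n.+1%:R.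
    rewrite (@le_trans _ _ n%:R)// ?ler_nat//.
    by near: n; exact: nbhs_infty_ger.
  by move: xn; rewrite ler_norml => /andP[? ?]; apply/andP; split; lra.
- exact: integrable_abse.
- apply/aeW => x n _; rewrite /f_ patchE; case: ifP => //= _.
  by rewrite normr0 lee_fin.
have -> : [sequence (\int[leb]_x f_ n x)%E]_n =
    (fun n => (F (m + n.+1%:R) - F (m - n.+1%:R))%:E).
  apply/funext => n; rewrite /= -integral_mkcond (@continuous_FTC2 _ f F)//.
  - by have := ltr0Sn R n; lra.
  - exact: continuous_subspaceT.
  - split; first by move=> x _; exact: ex_derive.
    + by apply: cvg_at_right_filter; exact: cF.
    + by apply: cvg_at_left_filter; exact: cF.
  - by move=> x _; rewrite derive1E; exact: derive_val.
move=> h; apply: (cvg_unique _ h) => //.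
by apply/fine_cvgP; split; [exact: nearW|exact: F0].
Unshelve. all: by end_near. Qed.

(** The integrand is the derivative of [(x - m) ^ k] times the density, a function that vanishes at
    infinity. *)
Lemma stein_identity m s k : s != 0 ->
  has_integral leb (fun x => k%:R * ((x - m) ^+ k.-1 * normal_pdf m s x)
     - (s ^+ 2)^-1 * ((x - m) ^+ k.+1 * normal_pdf m s x)) 0.
Proof.
move=> s0.
apply: (@has_integral_derive0 (fun x => (x - m) ^+ k * normal_pdf m s x) _ m).
- by move=> x; exact: is_derive_normal_moment.
- have cu : forall x, {for x, continuous (fun y : R => y - m)}.
    by move=> x; apply: cvgB; [exact: cvg_id|exact: cvg_cst].
  have cX : forall j x, {for x, continuous (fun y : R => (y - m) ^+ j)}.
    by move=> j x; exact: (continuous_comp (cu x) (@exprn_continuous _ j _)).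
  have cpdf : continuous (normal_pdf m s) by exact: continuous_normal_pdf.
  move=> x; apply: cvgB; apply: cvgM; try exact: cvg_cst;
    by apply: cvgM; [exact: cX|exact: cpdf].
- have i1 := integrable_normal_moment m s k.-1 s0.
  have i2 := integrable_normal_moment m s k.+1 s0.
  have [+ _] := has_integralB _ _ _ _ _
    (has_integralZ _ _ _ k%:R (has_integral_integrable _ _ i1))
    (has_integralZ _ _ _ (s ^+ 2)^-1 (has_integral_integrable _ _ i2)).
  exact.
have [C C0 hC] := normal_moment_le m s k.+1 s0.
have s20 : 2 * s != 0 by rewrite mulf_neq0// pnatr_eq0.
pose D := C * normal_peak (2 * s).
have D0 : 0 <= D by rewrite mulr_ge0// normal_peak_ge0.
(* With one more power of [u] the product is still bounded, which gives decay like [1 / |u|]. *)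
have bound u : 0 < `|u| -> `|u ^+ k * normal_pdf m s (m + u)| <= D / `|u|.
  move=> u0; rewrite ler_pdivlMr// mulrC -normrM mulrA -exprS.
  have -> : u ^+ k.+1 = (m + u - m) ^+ k.+1 by rewrite addrAC subrr add0r.
  by rewrite (le_trans (hC _))// ler_wpM2l// normal_pdf_ub.
apply: (@squeeze_cvgr _ _ _ _ (fun n => - (2 * D * n.+1%:R^-1))
  (fun n => 2 * D * n.+1%:R^-1)).
- apply: nearW => n /=; rewrite -ler_norml.
  have n0 : 0 < `|n.+1%:R : R| by rewrite normr_gt0 pnatr_eq0.
  have := bound n.+1%:R n0; have := bound (- n.+1%:R); rewrite normrN => /(_ n0).
  rewrite (ger0_norm (ler0n _ n.+1)).
  rewrite [m + _ - m]addrAC [m - _ - m]addrAC subrr !add0r.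
  move=> b1 b2; rewrite (le_trans (ler_normB _ _))// -mulrA mulr_natl mulr2n.
  exact: lerD b2 b1.
- rewrite -oppr0; apply: cvgN; rewrite -[X in _ --> X](mulr0 (2 * D)).
  by apply: cvgMl_tmp; exact: cvg_harmonic.
- rewrite -[X in _ --> X](mulr0 (2 * D)).
  by apply: cvgMl_tmp; exact: cvg_harmonic.
Qed.

(** Stein's identity solved for the higher moment, a recursion that starts from the total mass. *)
Lemma normal_moment_succ m s k a : s != 0 ->
  has_integral leb (fun x => (x - m) ^+ k.-1 * normal_pdf m s x) a ->
  has_integral leb (fun x => (x - m) ^+ k.+1 * normal_pdf m s x)
    (k%:R * s ^+ 2 * a).
Proof.
move=> s0 ka.
have h := has_integral_integrable _ _ (integrable_normal_moment m s k.+1 s0).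
have := has_integralB _ _ _ _ _ (has_integralZ _ _ _ k%:R ka)
    (has_integralZ _ _ _ (s ^+ 2)^-1 h).
move=> /has_integral_unique/(_ (stein_identity m s k s0)) e.
suff -> : k%:R * s ^+ 2 * a =
  fine (\int[leb]_x ((x - m) ^+ k.+1 * normal_pdf m s x)%:E)%E by [].
have ss : s ^+ 2 != 0 by rewrite sqrf_eq0.
by move/eqP: e; rewrite subr_eq0 mulrAC => /eqP ->; rewrite mulrAC mulVf// mul1r.
Qed.

Lemma normal_moments m s : s != 0 ->
  [/\ has_integral leb (fun x => (x - m) * normal_pdf m s x) 0,
     has_integral leb (fun x => (x - m) ^+ 2 * normal_pdf m s x) (s ^+ 2) &
     has_integral leb (fun x => (x - m) ^+ 4 * normal_pdf m s x) (3 * s ^+ 4)].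
Proof.
move=> s0.
have h0 : has_integral leb (fun x => (x - m) ^+ 0 * normal_pdf m s x) 1.
  under eq_fun do rewrite expr0 mul1r.
  by split; [exact: integrable_normal_pdf|exact: integral_normal_pdf].
have h1 := normal_moment_succ m s 0 1 s0 h0.
have h2 := normal_moment_succ m s 1 1 s0 h0.
have h4 := normal_moment_succ m s 3 _ s0 h2.
split.
- by move: h1; rewrite !mul0r; under eq_fun do rewrite expr1.
- by move: h2; rewrite mulr1 mul1r.
- by move: h4; rewrite mulr1 mul1r -mulrA -exprD.
Qed.

End normal_moments.

(** * Moments of Gaussian random variables *)

Section gaussian_law_moments.
Context {R : realType}.
Local Notation leb := (@lebesgue_measure R).

(** The Radon-Nikodym derivative of the normal law agrees almost everywhere with the density, since
    both have the same integral over every measurable set. *)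
Lemma has_integral_normal_prob (m s : R) (g : R -> R) a :
  measurable_fun setT g ->
  has_integral leb (fun x => g x * normal_pdf m s x) a ->
  has_integral (normal_prob m s) g a.
Proof.
move=> mg [gi ga]; have dom := normal_prob_dominates m s.
have mpdf : measurable_fun setT (EFin \o normal_pdf m s).
  by apply/measurable_EFinP; exact: measurable_normal_pdf.
have mg' : measurable_fun setT (EFin \o g) by exact/measurable_EFinP.
have fpdf : ae_eq leb setT (Radon_Nikodym_SigmaFinite.f (normal_prob m s) leb)
    (EFin \o normal_pdf m s).
  apply: integral_ae_eq => //.
  - exact: Radon_Nikodym_SigmaFinite.f_integrable.
  - by move=> E _ mE; rewrite -Radon_Nikodym_SigmaFinite.f_integral.
have ni : (normal_prob m s).-integrable setT (EFin \o g).
  apply/integrableP; split=> //; have /integrableP[_] := gi.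
  apply: le_lt_trans.
  rewrite -(Radon_Nikodym_SigmaFinite.change_of_variables dom)//; last first.
    exact: measurableT_comp.
  rewrite le_eqVlt; apply/orP; left; apply/eqP.
  apply: ae_eq_integral => //.
  - apply: emeasurable_funM; first exact: measurableT_comp.
    apply: (measurable_int leb).
    exact: Radon_Nikodym_SigmaFinite.f_integrable.
  - by apply: measurableT_comp => //; exact: (measurable_int leb gi).
  - apply: filterS fpdf => x /(_ I) /= -> _.
    by rewrite normrM EFinM (ger0_norm (normal_pdf_ge0 _ _ _)).
split=> //; rewrite -(Radon_Nikodym_change_of_variables dom)// -ga.
apply: ae_eq_integral => //.
- exact: emeasurable_funM.
- exact: (measurable_int leb gi).
- have := ae_eq_Radon_Nikodym_SigmaFinite dom measurableT.
  apply: filterS2 fpdf => x /(_ I) /= -> /(_ I) <- _.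
  by rewrite EFinM.
Qed.

Lemma has_integral_dirac (m : R) (g : R -> R) : measurable_fun setT g ->
  has_integral (\d_m : {measure set R -> \bar R}) g (g m).
Proof.
move=> mg; have mg' : measurable_fun setT (EFin \o g) by exact/measurable_EFinP.
split; last by rewrite integral_dirac// diracT mul1e.
apply/integrableP; split=> //; rewrite integral_dirac//; last first.
  exact: measurableT_comp.
by rewrite diracT mul1e/= ltry.
Qed.

Context {d : measure_display} {T : measurableType d} {P : probability T R}.

(** In the degenerate case the law is a Dirac mass and both central moments vanish, so the
    nondegenerate formulas persist with [s = 0]. *)
Lemma gaussian_law_moments (X : T -> R) : measurable_fun setT X ->
  gaussian_law P X -> exists m s : R,
  [/\ has_integral P X m, has_integral P (fun w => (X w - m) ^+ 2) (s ^+ 2) &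
      has_integral P (fun w => (X w - m) ^+ 4) (3 * s ^+ 4)].
Proof.
move=> mX [m [s [s0 PX]]].
have mc k : measurable_fun setT (fun x : R => (x - m) ^+ k).
  by apply: measurable_funX; exact: measurable_funB.
have mc1 : measurable_fun setT (fun x : R => x - m) by exact: measurable_funB.
have shift : has_integral P (fun w => X w - m) 0 -> has_integral P X m.
  move=> h; have := has_integralD _ _ _ _ _ h (has_integral_cst P m).
  by rewrite add0r; under eq_fun do rewrite subrK.
exists m, s; move: PX; have [->|sn0] := eqVneq s 0 => PX.
  have tr (g : R -> R) : measurable_fun setT g -> has_integral P (fun w => g (X w)) (g m).
    by move=> mg; exact: has_integral_law mX PX (has_integral_dirac m g mg).
  split.
  - by apply: shift; have := tr _ mc1; rewrite subrr.
  - by have := tr _ (mc 2%N); rewrite subrr.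
  - by have := tr _ (mc 4%N); rewrite subrr !expr0n/= mulr0.
have [h1 h2 h4] := normal_moments m s sn0.
have tr (g : R -> R) a : measurable_fun setT g ->
    has_integral leb (fun x => g x * normal_pdf m s x) a ->
    has_integral P (fun w => g (X w)) a.
  by move=> mg ga; exact: (@has_integral_law _ _ _ P _ (measurableTypeR R) X
    (normal_prob m s) g a mX PX (has_integral_normal_prob m s g a mg ga)).
split; first by apply: shift; exact: tr _ _ mc1 h1.
- exact: tr _ _ (mc 2%N) h2.
- exact: tr _ _ (mc 4%N) h4.
Qed.

Lemma centered_gaussian_moments (X : T -> R) : measurable_fun setT X ->
  gaussian_law P X -> has_integral P X 0 -> exists v : R,
  has_integral P (fun w => X w ^+ 2) v /\
  has_integral P (fun w => X w ^+ 4) (3 * v ^+ 2).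
Proof.
move=> mX gX X0; have [m [s [h1 h2 h4]]] := gaussian_law_moments X mX gX.
have m0 : m = 0 := has_integral_unique _ _ _ _ h1 X0.
exists (s ^+ 2); rewrite -exprM; rewrite m0 in h2 h4; split.
- by move: h2; under eq_fun do rewrite subr0.
- by move: h4; under eq_fun do rewrite subr0.
Qed.

End gaussian_law_moments.

(** * Squares of Gaussian linear combinations *)

Section equal_laws.
Context {d : measure_display} {T : measurableType d} {R : realType}.
Variable P : probability T R.

Lemma has_integral_eq_law (X Y : T -> R) (a : R) :
  measurable_fun setT X -> measurable_fun setT Y ->
  (forall A, measurable A -> P (X @^-1` A) = P (Y @^-1` A)) ->
  has_integral P Y a -> has_integral P X a.
Proof.
move=> mX mY XY [Yi Ya].
pose Y' : {RV P >-> R} := HB.pack Y (isMeasurableFun.Build _ _ _ _ _ mY).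
have mE : measurable_fun setT (@EFin R) by exact/measurable_EFinP.
apply: (@has_integral_law _ _ _ P _ R X (distribution P Y') id a mX) => //.
split; first exact: (integrable_pushforward mY mE Yi).
by rewrite -Ya; exact: (integral_pushforward mY mE Yi measurableT).
Qed.

End equal_laws.

(** * Inner products on the linear span of the noise *)

Section gaussian_span.
Context {d : measure_display} {T : measurableType d} {R : realType}.
Variables (P : probability T R) (xi : int -> {RV P >-> R}).
Implicit Types f g : T -> R.

(** These are the combinations that [gaussian_sequence] declares Gaussian. Times may repeat, so two
    of them are added by concatenating their families. *)
Definition in_span f : Prop := exists (n : nat) (t : 'I_n -> int) (c : 'I_n -> R),
  f = (fun w => \sum_(i < n) c i * xi (t i) w).

Lemma in_span_gen i : in_span (xi i).
Proof.
exists 1%N, (fun=> i), (fun=> 1); apply/funext => w.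
by rewrite big_ord1 mul1r.
Qed.

Lemma in_spanD f g : in_span f -> in_span g -> in_span (fun w => f w + g w).
Proof.
move=> [m [t [a ->]]] [n [u [b ->]]]; exists (m + n)%N.
exists (fun i : 'I_(m + n) => match fintype.split i with inl j => t j | inr k => u k end).
exists (fun i : 'I_(m + n) => match fintype.split i with inl j => a j | inr k => b k end).
apply/funext => w; rewrite big_split_ord/=; congr (_ + _); apply: eq_bigr => i _.
  by rewrite (unsplitK (inl i)).
by rewrite (unsplitK (inr i)).
Qed.

Lemma in_spanZ k f : in_span f -> in_span (fun w => k * f w).
Proof.
move=> [m [t [a ->]]]; exists m, t, (fun i => k * a i); apply/funext => w.
by rewrite mulr_sumr; apply: eq_bigr => i _; rewrite mulrA.
Qed.

Lemma in_span0 : in_span (fun=> 0).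
Proof.
by exists 0%N, (fun=> 0), (fun=> 0); apply/funext => w; rewrite big_ord0.
Qed.

Lemma measurable_in_span f : in_span f -> measurable_fun setT f.
Proof.
move=> [m [t [a ->]]]; apply: measurable_sum => i.
by apply: measurable_funM => //; exact: measurable_funPT.
Qed.

Hypotheses (xi_gaussian : gaussian_sequence xi) (xi_centered : centered_sequence xi).

(** Integrability comes from the Gaussian law, whose mean is then zero by centering. *)
Lemma has_integral_gen i : has_integral P (xi i) 0.
Proof.
have gxi : gaussian_law P (xi i).
  have := xi_gaussian 1 (fun=> i) (fun=> 1).
  by congr gaussian_law; apply/funext => w; rewrite big_ord1 mul1r.
have mxi := measurable_in_span _ (in_span_gen i).
have [m [s [h _ _]]] := gaussian_law_moments (xi i) mxi gxi.
suff m0 : m = 0 by rewrite -m0.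
by have := xi_centered i; rewrite unlock h.2 => -[].
Qed.

Lemma in_span_moments f : in_span f -> exists v : R,
  has_integral P (fun w => f w ^+ 2) v /\
  has_integral P (fun w => f w ^+ 4) (3 * v ^+ 2).
Proof.
move=> sf; have mf := measurable_in_span f sf.
case: sf mf => m [t [a ->]] mf; apply: centered_gaussian_moments => //.
have := has_integral_sum P _ (index_enum 'I_m) _ _ (fun i =>
  has_integralZ _ _ _ (a i) (has_integral_gen (t i))).
by rewrite [X in has_integral _ _ X]big1// => i _; rewrite mulr0.
Qed.

(** On the span, whose elements are centered and square integrable, this is the covariance. *)
Definition ip f g : R := fine (\int[P]_w (f w * g w)%:E)%E.

Lemma ipC f g : ip f g = ip g f.
Proof. by rewrite /ip; under eq_integral do rewrite mulrC. Qed.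

Lemma has_integral_ipP f g a :
  has_integral P (fun w => f w * g w) a -> ip f g = a.
Proof. by move=> [_ h]; rewrite /ip h. Qed.

(** Polarization: [f g] is a quarter of [(f + g)^2 - (f - g)^2], and [f + g] and [f - g] are again
    in the span. *)
Lemma has_integral_ip f g : in_span f -> in_span g ->
  has_integral P (fun w => f w * g w) (ip f g).
Proof.
move=> sf sg.
have [a [ha _]] := in_span_moments _ (in_spanD _ _ sf sg).
have [b [hb _]] := in_span_moments _ (in_spanD _ _ sf (in_spanZ (- 1) _ sg)).
suff h : has_integral P (fun w => f w * g w) (4^-1 * (a - b)).
  by rewrite (has_integral_ipP _ _ _ h).
have := has_integralZ _ _ _ 4^-1 (has_integralB _ _ _ _ _ ha hb).
by congr has_integral; apply/funext => w; field.
Qed.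

Lemma ip_linear k f f' g : in_span f -> in_span f' -> in_span g ->
  ip (fun w => k * f w + f' w) g = k * ip f g + ip f' g.
Proof.
move=> sf sf' sg; apply: has_integral_ipP.
have := has_integralD _ _ _ _ _
  (has_integralZ _ _ _ k (has_integral_ip _ _ sf sg)) (has_integral_ip _ _ sf' sg).
by congr has_integral; apply/funext => w; rewrite mulrDl mulrA.
Qed.

(* Isserlis' formula, obtained by polarization from the fourth moments of
   [f + g], [f - g], [f] and [g]. *)
Lemma in_span_isserlis f g : in_span f -> in_span g ->
  has_integral P (fun w => f w ^+ 2 * g w ^+ 2)
    (ip f f * ip g g + 2 * ip f g ^+ 2).
Proof.
move=> sf sg.
have [p [hp2 hp4]] := in_span_moments _ (in_spanD _ _ sf sg).
have [q [hq2 hq4]] := in_span_moments _ (in_spanD _ _ sf (in_spanZ (- 1) _ sg)).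
have [a [ha2 ha4]] := in_span_moments _ sf.
have [b [hb2 hb4]] := in_span_moments _ sg.
have ffE : ip f f = a by exact: has_integral_ipP.
have ggE : ip g g = b by exact: has_integral_ipP.
have hfg := has_integral_ip _ _ sf sg; rewrite ffE ggE.
have pE : p = a + b + 2 * ip f g.
  apply: has_integral_unique hp2 _.
  have := has_integralD _ _ _ _ _ (has_integralD _ _ _ _ _ ha2 hb2)
    (has_integralZ _ _ _ 2 hfg).
  by congr has_integral; apply/funext => w; ring.
have qE : q = a + b - 2 * ip f g.
  apply: has_integral_unique hq2 _.
  have := has_integralB _ _ _ _ _ (has_integralD _ _ _ _ _ ha2 hb2)
    (has_integralZ _ _ _ 2 hfg).
  by congr has_integral; apply/funext => w; ring.
(* This is [(f + g)^4 + (f - g)^4 - 2 (f^4 + g^4) = 12 f^2 g^2]. *)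
have := has_integralZ _ _ _ 12^-1 (has_integralB _ _ _ _ _
  (has_integralD _ _ _ _ _ hp4 hq4)
  (has_integralZ _ _ _ 2 (has_integralD _ _ _ _ _ ha4 hb4))).
congr has_integral; first by apply/funext => w; field.
by rewrite pE qE; field.
Qed.

(** The square of the centered sum expands into products of centered squares, and by Isserlis'
    formula the covariance of [F s ^ 2] and [F t ^ 2] is [2 * ip (F s) (F t) ^ 2]. *)
Lemma has_integral_variance_sum_sqr (n : nat) (F : nat -> T -> R) :
  (forall t, in_span (F t)) ->
  has_integral P (fun w =>
      (\sum_(t < n) F t w ^+ 2 - \sum_(t < n) ip (F t) (F t)) ^+ 2)
    (2 * \sum_(s < n) \sum_(t < n) ip (F s) (F t) ^+ 2).
Proof.
move=> sF; pose q s := ip (F s) (F s).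
have h2 s : has_integral P (fun w => F s w ^+ 2) (q s).
  by exact: has_integral_ip.
have hst s t : has_integral P
    (fun w => (F s w ^+ 2 - q s) * (F t w ^+ 2 - q t)) (2 * ip (F s) (F t) ^+ 2).
  have := has_integralD _ _ _ _ _ (has_integralB _ _ _ _ _
    (in_span_isserlis _ _ (sF s) (sF t))
    (has_integralD _ _ _ _ _ (has_integralZ _ _ _ (q t) (h2 s))
      (has_integralZ _ _ _ (q s) (h2 t)))) (has_integral_cst P (q s * q t)).
  by congr has_integral; [apply/funext => w|]; rewrite /q; ring.
have := has_integral_sum P _ (index_enum 'I_n) _ _ (fun s : 'I_n =>
  has_integral_sum P _ (index_enum 'I_n) _ _ (fun t : 'I_n => hst s t)).
congr has_integral.
  apply/funext => w; rewrite -sumrB expr2 mulr_suml; apply: eq_bigr => s _.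
  by rewrite mulr_sumr.
by rewrite mulr_sumr; apply: eq_bigr => s _; rewrite mulr_sumr.
Qed.

Hypothesis xi_stationary : stationary_sequence xi.

(** Stationarity moves the times [0] and [i - j] by [j] to [j] and [i]. Applied to preimages under
    the product of two coordinates, it shows that the two products have the same law. *)
Lemma ip_gen i j : ip (xi i) (xi j) = autocovariance xi (i - j).
Proof.
have m2 (B : set R) : measurable B ->
    measurable [set t : 2.-tuple R | B (tnth t ord0 * tnth t ord_max)].
  move=> mB; rewrite -[X in measurable X]setTI.
  have : measurable_fun setT (fun t : 2.-tuple R => tnth t ord0 * tnth t ord_max).
    by apply: measurable_funM; exact: measurable_tnth.
  exact.
have mM a b : measurable_fun setT (fun w => xi a w * xi b w).
  by apply: measurable_funM; exact: measurable_funPT.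
apply: has_integral_ipP; apply: (has_integral_eq_law _ _ _ _ (mM _ _) (mM 0 (i - j))).
  move=> A mA; pose t := fun k : 'I_2 => if k == ord0 then 0 else i - j.
  have := xi_stationary 2 t j _ (m2 A mA).
  have e (h : int) : [set w | [set t0 : 2.-tuple R | A (tnth t0 ord0 * tnth t0 ord_max)]
      [tuple xi (t i0 + h) w | i0 < 2]] = [set w | A (xi h w * xi (i - j + h) w)].
    by apply/seteqP; split=> w; rewrite /= !tnth_mktuple /t/= add0r.
  rewrite e subrK => h1.
  have -> : (fun w => xi i w * xi j w) @^-1` A = [set w | A (xi j w * xi i w)].
    by apply/seteqP; split=> w; rewrite /= mulrC.
  rewrite h1; congr (P _).
  by apply/seteqP; split=> w; rewrite /= !tnth_mktuple /t/=.
have := has_integral_ip _ _ (in_span_gen 0) (in_span_gen (i - j)).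
by congr has_integral; rewrite /autocovariance unlock.
Qed.

End gaussian_span.

(** * Sequences and sums *)

Section subsequences.
Context {R : realType}.
Implicit Types (u : nat -> R) (l : R).

Lemma nat_root_exists m : (0 < m)%N ->
  exists r : nat -> nat, forall n, (r n ^ m <= n < (r n).+1 ^ m)%N.
Proof.
move=> m0.
suff /choice[r hr] : forall n, exists k, (k ^ m <= n < k.+1 ^ m)%N by exists r.
move=> n; have exk : exists k, (k ^ m <= n)%N by exists 0%N; rewrite exp0n.
have bk k : (k ^ m <= n)%N -> (k <= n)%N.
  case: k => // k; apply: leq_trans; rewrite -[X in (X <= _)%N]expn1.
  by rewrite leq_pexp2l.
have [k kn kmax] := ex_maxnP exk bk; exists k; rewrite kn/= ltnNge.
by apply/negP => /kmax; rewrite ltnn.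
Qed.

(* A nondecreasing sequence is controlled between two consecutive powers
   [k ^ m] and [(k + 1) ^ m], whose ratio tends to 1. *)
Lemma cvg_mean_powers m u l : (0 < m)%N ->
  {homo u : p q / (p <= q)%N >-> p <= q} -> (forall n, 0 <= u n) ->
  ((k ^ m)%:R)^-1 * u (k ^ m)%N @[k --> \oo] --> l ->
  n%:R^-1 * u n @[n --> \oo] --> l.
Proof.
move=> m0 u_homo u0 ul; have [r hr] := nat_root_exists m m0.
have r_oo : r n @[n --> \oo] --> \oo.
  apply/cvgnyPge => K; near=> n.
  have Kn : (K ^ m <= n)%N by near: n; exact: nbhs_infty_ge.
  have /andP[_ nr] := hr n.
  by have := leq_ltn_trans Kn nr; rewrite ltn_exp2r// ltnS.
pose v k := ((k ^ m)%:R)^-1 * u (k ^ m)%N.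
(* With [k = r n], monotonicity gives [u (k ^ m) / (k + 1) ^ m <= u n / n <= u ((k + 1) ^ m) / k ^
   m]; [h k] corrects the mismatched denominators. *)
pose h k : R := (k%:R / k.+1%:R) ^+ m.
have h1 : h k @[k --> \oo] --> (1 : R).
  suff : h k @[k --> \oo] --> (1 ^+ m : R) by rewrite expr1n.
  apply: (@cvg_comp _ _ _ (fun k : nat => k%:R / k.+1%:R : R) (fun x => x ^+ m));
    last exact: exprn_continuous.
  have e : (fun k : nat => k%:R / k.+1%:R : R) = (fun k => 1 - harmonic k).
    apply/funext => k; rewrite /harmonic/= -[X in X / _](addrK 1).
    by rewrite natr1 mulrBl mul1r divff// pnatr_eq0.
  rewrite e; suff : (fun k => 1 - harmonic k) @ \oo --> (1 - 0 : R) by rewrite subr0.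
  apply: cvgB; first exact: cvg_cst.
  exact: cvg_harmonic.
have lo : h (r n) * v (r n) @[n --> \oo] --> l.
  suff : h (r n) * v (r n) @[n --> \oo] --> 1 * l by rewrite mul1r.
  by apply: (@cvg_comp _ _ _ r (fun k => h k * v k) _ _ _ r_oo); exact: cvgM.
have hi : (h (r n))^-1 * v (r n).+1 @[n --> \oo] --> l.
  suff : (h (r n))^-1 * v (r n).+1 @[n --> \oo] --> 1^-1 * l by rewrite invr1 mul1r.
  apply: (@cvg_comp _ _ _ r (fun k => (h k)^-1 * v k.+1) _ _ _ r_oo); apply: cvgM.
    by apply: cvgV => //; exact: oner_neq0.
  by rewrite (cvg_shiftS v).
apply: (squeeze_cvgr _ lo hi).
near=> n; have n0 : (0 < n)%N by near: n; exact: nbhs_infty_gt.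
have rn0 : (0 < r n)%N.
  have /andP[_] := hr n; case: (r n) => //; rewrite exp1n.
  by move=> /(leq_trans n0).
have /andP[rn nr] := hr n.
have p0 : (0 : R) < n%:R by rewrite ltr0n.
have rm0 : (0 : R) < (r n ^ m)%:R by rewrite ltr0n expn_gt0 rn0.
have rm1 : (0 : R) < ((r n).+1 ^ m)%:R by rewrite ltr0n expn_gt0.
have hE : h (r n) = (r n ^ m)%:R / ((r n).+1 ^ m)%:R.
  by rewrite /h expr_div_n -!natrX.
have vlo : h (r n) * v (r n) = (((r n).+1 ^ m)%:R)^-1 * u (r n ^ m)%N.
  rewrite hE /v; move: rm0 rm1; set a := (_ ^ _)%:R; set b := (_ ^ _)%:R => a0 b0.
  by field; rewrite !gt_eqF.
have vhi : (h (r n))^-1 * v (r n).+1 = ((r n ^ m)%:R)^-1 * u ((r n).+1 ^ m)%N.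
  rewrite hE /v; move: rm0 rm1; set a := (_ ^ _)%:R; set b := (_ ^ _)%:R => a0 b0.
  by field; rewrite !gt_eqF.
rewrite vlo vhi; apply/andP; split; apply: ler_pM; rewrite ?invr_ge0 ?ler0n//.
- by rewrite lef_pV2 ?posrE// ler_nat ltnW.
- exact: u_homo.
- by rewrite lef_pV2 ?posrE// ler_nat.
- by apply: u_homo; exact: ltnW.
Unshelve. all: by end_near. Qed.

End subsequences.

(** * Bounds for autoregressive recursions and covariance sums *)

Section sums.
Context {R : realType}.

(** Summing the recursion shifts the index by one, which costs only the last term as [x 0 = 0]. Sums
    of solutions are thus compared with sums of inputs without solving the recursion. *)
Lemma ar_sum (theta : R) (x y : nat -> R) n : x 0 = 0 ->
  (forall t, x t.+1 = theta * x t + y t.+1) ->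
  (1 - theta) * \sum_(t < n) x t.+1 = \sum_(t < n) y t.+1 - theta * x n.
Proof.
move=> x0 xS; elim: n => [|n IH]; first by rewrite !big_ord0 x0; ring.
by rewrite !big_ord_recr/= mulrDr IH xS; ring.
Qed.

Lemma ar_ge0 (theta : R) (x y : nat -> R) n : 0 <= theta -> x 0 = 0 ->
  (forall t, x t.+1 = theta * x t + y t.+1) -> (forall t, 0 <= y t) -> 0 <= x n.
Proof.
move=> t0 x0 xS y0; elim: n => [|n IH]; first by rewrite x0.
by rewrite xS addr_ge0// mulr_ge0.
Qed.

(** The bound is the fixed point of [x |-> theta * x + b]. *)
Lemma ar_le (theta b : R) (x y : nat -> R) n : 0 <= theta -> theta < 1 ->
  x 0 = 0 -> (forall t, x t.+1 = theta * x t + y t.+1) ->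
  (forall t, y t <= b) -> 0 <= b -> x n <= b / (1 - theta).
Proof.
move=> t0 t1 x0 xS yb b0; have t10 : 0 < 1 - theta by rewrite subr_gt0.
elim: n => [|n IH]; first by rewrite x0 divr_ge0// ltW.
have e : b / (1 - theta) = theta * (b / (1 - theta)) + b.
  by field; rewrite gt_eqF.
by rewrite xS e lerD// ler_wpM2l.
Qed.

(** Here [g], [r] and [k] will be the covariances of [(X_s, X_t)], [(xi_s, X_t)] and [(xi_s, xi_t)].
    Each passage from one to the next costs a factor [1 / (1 - theta)], in upper bounds and in sums
    alike. One factor of the square is bounded uniformly and the other is summed, hence the fourth
    power. *)
Lemma ar_kernel_sum_sqr (theta C : R) (g r k : nat -> nat -> R) n :
  0 <= theta -> theta < 1 -> 0 <= C ->
  (forall t, g 0 t = 0) -> (forall s t, g s.+1 t = theta * g s t + r s.+1 t) ->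
  (forall s, r s 0 = 0) -> (forall s t, r s t.+1 = theta * r s t + k s t.+1) ->
  (forall s t, 0 <= k s t <= C) ->
  \sum_(s < n) \sum_(t < n) g s.+1 t.+1 ^+ 2 <=
  C / (1 - theta) ^+ 4 * \sum_(s < n) \sum_(t < n) k s.+1 t.+1.
Proof.
move=> t0 t1 C0 g0 gS r0 rS kC; have t10 : 0 < 1 - theta by rewrite subr_gt0.
have k0 s t : 0 <= k s t by case/andP: (kC s t).
have kl s t : k s t <= C by case/andP: (kC s t).
have rge s t : 0 <= r s t by exact: (ar_ge0 theta (r s) (k s)).
have rle s t : r s t <= C / (1 - theta) by exact: (ar_le theta C (r s) (k s)).
have gge s t : 0 <= g s t by exact: (ar_ge0 theta (g ^~ t) (r ^~ t)).
have gle s t : g s t <= C / (1 - theta) ^+ 2.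
  rewrite expr2 invfM mulrA; apply: (ar_le theta _ (g ^~ t) (r ^~ t)) => //.
  by rewrite divr_ge0// ltW.
have sg : (1 - theta) * (\sum_(s < n) \sum_(t < n) g s.+1 t.+1) <=
    \sum_(s < n) \sum_(t < n) r s.+1 t.+1.
  rewrite exchange_big mulr_sumr [leRHS]exchange_big; apply: ler_sum => t _.
  by rewrite (ar_sum theta (g ^~ t.+1) (r ^~ t.+1))// gerBl mulr_ge0.
have sr : (1 - theta) * (\sum_(s < n) \sum_(t < n) r s.+1 t.+1) <=
    \sum_(s < n) \sum_(t < n) k s.+1 t.+1.
  rewrite mulr_sumr; apply: ler_sum => s _.
  by rewrite (ar_sum theta (r s.+1) (k s.+1))// gerBl mulr_ge0.
apply: (@le_trans _ _ (C / (1 - theta) ^+ 2 * \sum_(s < n) \sum_(t < n) g s.+1 t.+1)).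
  rewrite mulr_sumr; apply: ler_sum => s _; rewrite mulr_sumr.
  by apply: ler_sum => t _; rewrite expr2 ler_wpM2r.
have -> : C / (1 - theta) ^+ 4 * \sum_(s < n) \sum_(t < n) k s.+1 t.+1 =
    C / (1 - theta) ^+ 2 * ((\sum_(s < n) \sum_(t < n) k s.+1 t.+1) / (1 - theta) ^+ 2).
  by field; rewrite gt_eqF.
apply: ler_wpM2l; first by rewrite divr_ge0// exprn_ge0// ltW.
rewrite ler_pdivlMr ?exprn_gt0//.
by apply: le_trans sr; rewrite mulrC expr2 -mulrA ler_wpM2l// ltW.
Qed.

(** In a fixed row each distance occurs at most twice, once on either side of the diagonal. *)
Lemma sum_dist_le (k : nat -> R) (n : nat) : (forall i, 0 <= k i) ->
  \sum_(s < n) \sum_(t < n) k `|s%:Z - t%:Z|%N <=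
  2 * n%:R * \sum_(i < n) k i.
Proof.
move=> k0.
have row s : (s < n)%N ->
    \sum_(t < n) k `|s%:Z - t%:Z|%N <= 2 * \sum_(i < n) k i.
  move=> sn; rewrite mulr_natl mulr2n -(big_mkord xpredT (fun t => k `|s%:Z - t%:Z|%N)).
  have ge0 (a b : nat) : 0 <= \sum_(a <= i < b) k i by apply: sumr_ge0.
  (* The left part, read backwards, includes the diagonal and has the distances [0, ..., s]; the
     right part has the distances [1, ..., n - s - 1]. *)
  rewrite (big_cat_nat (leq0n s.+1) sn)/= -(big_mkord xpredT k) lerD//.
    rewrite big_nat_rev/= add0n [leRHS](big_cat_nat (leq0n s.+1) sn)/=.
    rewrite ler_wpDr// le_eqVlt; apply/orP; left; apply/eqP.
    by apply: eq_big_nat => i /andP[_ si]; congr k; lia.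
  have le1 : (1 <= n - s)%N by rewrite subn_gt0.
  rewrite -{1}add1n big_addn.
  rewrite [leRHS](big_cat_nat (leq0n 1) (leq_trans le1 (leq_subr _ _)))/=.
  rewrite (big_cat_nat le1 (leq_subr _ _))/= ler_wpDl// ler_wpDr//.
  rewrite le_eqVlt; apply/orP; left; apply/eqP.
  by apply: eq_big_nat => i _; congr k; lia.
apply: (@le_trans _ _ (\sum_(s < n) 2 * \sum_(i < n) k i)).
  by apply: ler_sum => s _; exact: row.
by rewrite sumr_const card_ord -mulr_natl; lra.
Qed.

(* Splitting the sum at [N ^ q] gives a gain [N ^- 2] over the trivial bound. *)
Lemma sum_powers_le (k : nat -> R) (C : R) (q N : nat) : (2 <= q)%N ->
  (forall i, 0 <= k i <= C) ->
  (forall i, (N.+1 ^ q <= i)%N -> k i <= C / N.+1%:R ^+ 2) ->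
  \sum_(i < N.+1 ^ (2 * q)) k i <=
  2 * C * (N.+1 ^ (2 * q))%:R / N.+1%:R ^+ 2.
Proof.
move=> q2 kC kd; set M := N.+1; set n := (M ^ (2 * q))%N.
have C0 : 0 <= C by have /andP[h1 h2] := kC 0; exact: le_trans h1 h2.
have qn : (M ^ q <= n)%N by rewrite leq_pexp2l// leq_pmull.
rewrite -(big_mkord xpredT k) (big_cat_nat (leq0n _) qn)/=.
have M0 : 0 < (M%:R : R) ^+ 2 by rewrite exprn_gt0// ltr0n.
have -> : 2 * C * n%:R / M%:R ^+ 2 = C * (n%:R / M%:R ^+ 2) + n%:R * (C / M%:R ^+ 2).
  by field; rewrite pnatr_eq0.
apply: lerD.
  (* The head has [M ^ q] terms, and [M ^ q * M ^ 2 <= M ^ (2 * q)] because [2 <= q]. *)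
  apply: (@le_trans _ _ (\sum_(0 <= i < M ^ q) C)).
    by apply: ler_sum => i _; case/andP: (kC i).
  rewrite sumr_const_nat subn0 -[leLHS]mulr_natr ler_wpM2l// ler_pdivlMr// -natrX -natrM.
  by rewrite ler_nat -expnD leq_pexp2l// mul2n -addnn leq_add2l.
apply: (@le_trans _ _ (\sum_(M ^ q <= i < n) C / M%:R ^+ 2)).
  by rewrite big_nat [leRHS]big_nat; apply: ler_sum => i /andP[ni _]; exact: kd.
rewrite sumr_const_nat -[leLHS]mulr_natl ler_wpM2r ?ler_nat ?leq_subr//.
by rewrite divr_ge0// ltW.
Qed.

(** Induction needs the sharper bound [2 - 1 / (m + 1)]; its step is
    [1 / (x + 1) ^ 2 <= 1 / x - 1 / (x + 1)]. *)
Lemma sum_inv_sqr_le n : \sum_(i < n) (i.+1%:R ^+ 2)^-1 <= 2 :> R.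
Proof.
suff h m : \sum_(i < m.+1) (i.+1%:R ^+ 2)^-1 <= 2 - m.+1%:R^-1 :> R.
  apply: (@le_trans _ _ (\sum_(i < n.+1) (i.+1%:R ^+ 2)^-1)).
    by rewrite big_ord_recr/= lerDl invr_ge0 exprn_ge0.
  by rewrite (le_trans (h n))// gerBl invr_ge0.
elim: m => [|m IH]; first by rewrite big_ord1 expr1n invr1; lra.
rewrite big_ord_recr/= (le_trans (lerD IH (lexx _)))//.
have m0 : 0 < m.+1%:R :> R by rewrite ltr0n.
have -> : m.+2%:R = m.+1%:R + 1 :> R by rewrite natr1.
move: m0; set x := m.+1%:R => x0; have x10 : 0 < x + 1 by lra.
have -> : 2 - (x + 1)^-1 = 2 - x^-1 + (x * (x + 1))^-1.
  by field; rewrite !gt_eqF.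
by rewrite lerD2l lef_pV2 ?posrE ?mulr_gt0 ?exprn_gt0// expr2 ler_wpM2r; lra.
Qed.

End sums.

(** * The stationary variance *)

Section covariance_decay.
Context {R : realType}.

(* Zygmund's condition with [delta = 1 - H] bounds [L k * k `^ (2 * H - 2)] by a
   multiple of [k `^ (H - 1)], for all positive [k] at the cost of the constant. *)
Lemma slowly_varying_decay (H : R) (L : R -> R) (k : nat -> R) : H < 1 ->
  zygmund_slowly_varying L -> (forall i, 0 <= k i) ->
  (forall i, (0 < i)%N -> k i = L i%:R * i%:R `^ (2 * H - 2)) ->
  exists2 C, 0 <= C & forall i, (0 < i)%N -> k i <= C * i%:R `^ (- (1 - H)).
Proof.
move=> H1 Ls k0 kE; set a := 1 - H; have a0 : 0 < a by rewrite subr_gt0.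
have [M [M0 hM]] := Ls a a0.
pose n := (Num.truncn M).+1; have Mn : M < n%:R by exact: truncnS_gt.
have n0 : 0 < n%:R :> R by rewrite ltr0n.
(* From [n] on, [i ^ (- a) * L i] is at most its value [K] at [n]. Below [n], the bound [k i <= S]
   is enough because [(n / i) ^ a >= 1]. *)
pose K := n%:R `^ (- a) * L n%:R.
pose S := \sum_(i < n) k i.
have S0 : 0 <= S by apply: sumr_ge0.
exists (Num.max K (S * n%:R `^ a)) => [|i i0].
  by rewrite le_max (mulr_ge0 S0 (powR_ge0 _ _)) orbT.
have i0R : 0 < i%:R :> R by rewrite ltr0n.
have [ni|ni] := leqP n i.
  apply: (@le_trans _ _ (K * i%:R `^ (- a))); last first.
    by rewrite ler_wpM2r ?powR_ge0// le_max lexx.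
  have [_ h] := hM n%:R i%:R Mn (etrans (ler_nat _ _ _) ni).
  rewrite kE//; have -> : 2 * H - 2 = - a + - a by rewrite /a; ring.
  rewrite powRD; last by apply/implyP => _; rewrite gt_eqF.
  by rewrite mulrA [L _ * _]mulrC ler_wpM2r ?powR_ge0.
apply: (@le_trans _ _ (S * n%:R `^ a * i%:R `^ (- a))); last first.
  by rewrite ler_wpM2r ?powR_ge0// le_max lexx orbT.
apply: (@le_trans _ _ S).
  by rewrite /S (bigD1 (Ordinal ni))//= lerDl sumr_ge0.
rewrite -mulrA ler_peMr// powRN ler_pdivlMr ?powR_gt0// mul1r.
by rewrite ge0_ler_powR ?nnegrE ?ltW// ltr_nat.
Qed.

(** If [q * a >= 2], then [i >= (N + 1) ^ q] gives [i ^ a >= (N + 1) ^ 2]. *)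
Lemma powR_decay (a : R) : 0 < a -> exists2 q, (2 <= q)%N &
  forall N i, (N.+1 ^ q <= i)%N -> i%:R `^ (- a) <= (N.+1%:R ^+ 2)^-1.
Proof.
move=> a0; pose q := maxn 2 (Num.truncn (2 / a)).+1.
exists q => [|N i Ni]; first by rewrite leq_maxl.
have qa : 2 <= q%:R * a.
  rewrite -ler_pdivrMr//; apply: ltW; apply: (lt_le_trans (truncnS_gt _)).
  by rewrite ler_nat leq_maxr.
have N1 : 1 <= N.+1%:R :> R by rewrite ler1n.
rewrite powRN lef_pV2 ?posrE ?exprn_gt0 ?ltr0n//; last first.
  by rewrite powR_gt0// ltr0n; apply: leq_trans Ni; rewrite expn_gt0.
rewrite -powR_mulrn ?ler0n//; apply: (le_trans (ler_powR N1 qa)).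
rewrite powRrM powR_mulrn ?ler0n// -natrX.
by rewrite ge0_ler_powR ?nnegrE ?ler0n ?ler_nat// ltW.
Qed.

End covariance_decay.

(** * Monotonicity and continuity of the stationary variance *)

Section variance_function.
Context {R : realType}.
Variables (rho : int -> R) (C : R).
Hypotheses (rho_ge0 : forall k, 0 <= rho k) (rho_le : forall k, rho k <= C)
  (rho0 : rho 0 = 1).
Implicit Types v w : R.

(** The square truncation is the variance at time [n] of the autoregression started at zero, when
    [rho] is the autocovariance of the noise. *)
Definition truncated_variance (n : nat) v : R :=
  \sum_(i < n) \sum_(j < n) v ^+ (i + j)%N * rho (i%:Z - j%:Z).

Lemma geometric_sum_cvg v : 0 <= v -> v < 1 ->
  \sum_(i < n) v ^+ i @[n --> \oo] --> (1 - v)^-1.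
Proof.
move=> v0 v1.
have := @cvg_geometric_series R 1 v; rewrite ger0_norm// => /(_ v1).
rewrite div1r; suff -> : series (geometric 1 v) = (fun n => \sum_(i < n) v ^+ i) by [].
apply/funext => n; rewrite /series/= big_mkord; apply: eq_bigr => i _.
by rewrite /= mul1r.
Qed.

Lemma geometric_sum_le v n : 0 <= v -> v < 1 -> \sum_(i < n) v ^+ i <= (1 - v)^-1.
Proof.
move=> v0 v1; have h := geometric_sum_cvg v v0 v1.
rewrite -(cvg_lim _ h)//.
apply: (@nondecreasing_cvgn_le _ (fun n => \sum_(i < n) v ^+ i)); last exact: cvgP h.
by apply/nondecreasing_seqP => m; rewrite big_ord_recr/= lerDl exprn_ge0.
Qed.

(** The terms are nonnegative and at most [C v^i v^j]. From row [i] the square misses at most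
    [C v^i v^n / (1 - v)], hence at most [C v^n / (1 - v)^2] from the first [n] complete rows. *)
Lemma truncated_variance_cvg v : 0 < v -> v < 1 ->
  truncated_variance n v @[n --> \oo] --> stationary_variance rho v.
Proof.
move=> v0 v1; set g := (1 - v)^-1.
have C0 : 0 <= C := le_trans (rho_ge0 0) (rho_le 0).
have g0 : 0 < g by rewrite invr_gt0 subr_gt0.
pose a i j := v ^+ (i + j)%N * rho (i%:Z - j%:Z).
have a0 i j : 0 <= a i j by rewrite mulr_ge0// exprn_ge0// ltW.
have aC i j : a i j <= C * v ^+ i * v ^+ j.
  by rewrite /a -mulrA -exprD mulrC ler_wpM2r// exprn_ge0// ltW.
have nd (u : nat -> R) : (forall i, 0 <= u i) ->
    {homo series u : p q / (p <= q)%N >-> p <= q}.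
  by move=> u0; apply/nondecreasing_seqP => m; rewrite /series/= big_nat_recr//= lerDl.
pose row i := series (a i).
have rowC i n : row i n <= C * v ^+ i * g.
  rewrite /row /series/= big_mkord (le_trans (ler_sum _ (fun (j : 'I_n) _ => aC i j)))//.
  by rewrite -mulr_sumr ler_wpM2l ?mulr_ge0 ?exprn_ge0 ?geometric_sum_le// ltW.
have row_cvg i : cvgn (row i).
  apply: nondecreasing_is_cvgn; first exact: nd.
  by exists (C * v ^+ i * g) => _ [n _ <-].
pose S i := limn (row i).
have rowS i n : row i n <= S i by apply: nondecreasing_cvgn_le => //; exact: nd.
have Srow i n : S i <= row i n + C * v ^+ i * (v ^+ n * g).
  apply: limr_le => //; near=> m.
  have nm : (n <= m)%N by near: m; exact: nbhs_infty_ge.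
  rewrite /row /series/= (big_cat_nat (leq0n n) nm)/= lerD2l.
  apply: (@le_trans _ _ (\sum_(n <= j < m) C * v ^+ i * v ^+ j)).
    by apply: ler_sum => j _; exact: aC.
  rewrite -mulr_sumr ler_wpM2l ?mulr_ge0 ?exprn_ge0 ?(ltW v0)//.
  rewrite -{1}(add0n n) big_addn big_mkord.
  under eq_bigr do rewrite exprD mulrC.
  by rewrite -mulr_sumr ler_wpM2l ?exprn_ge0 ?geometric_sum_le ?(ltW v0).
have S0 i : 0 <= S i.
  by have := rowS i 0%N; rewrite /row /series/= big_geq.
have SC i : S i <= C * v ^+ i * g.
  by apply: limr_le => //; apply: nearW.
have Scvg : cvgn (series S).
  apply: nondecreasing_is_cvgn; first exact: nd.
  exists (C * g * g) => _ [n _ <-]; rewrite /series/= big_mkord.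
  apply: (le_trans (ler_sum _ (fun (j : 'I_n) _ => SC j))).
  rewrite -mulr_suml -mulr_sumr ler_wpM2r ?(ltW g0)// ler_wpM2l//.
  by rewrite geometric_sum_le// ltW.
have -> : stationary_variance rho v = limn (series S) by [].
have vn : series S n - C * g ^+ 2 * v ^+ n @[n --> \oo] --> limn (series S).
  suff : series S n - C * g ^+ 2 * v ^+ n @[n --> \oo] -->
      limn (series S) - C * g ^+ 2 * 0 by rewrite mulr0 subr0.
  apply: cvgB => //; apply: cvgMl_tmp; apply: cvg_expr.
  by rewrite ger0_norm// ltW.
have tE n : truncated_variance n v = \sum_(i < n) row i n.
  by apply: eq_bigr => i _; rewrite /row /series/= big_mkord.
apply: (squeeze_cvgr _ vn Scvg); apply: nearW => n.
rewrite tE /series/= big_mkord; apply/andP; split; last first.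
  by apply: ler_sum => i _; exact: rowS.
rewrite lerBlDr; apply: (le_trans (ler_sum _ (fun (j : 'I_n) _ => Srow j n))).
rewrite big_split/= lerD2l -mulr_suml -mulr_sumr.
have -> : C * g ^+ 2 * v ^+ n = C * g * (v ^+ n * g) by ring.
rewrite ler_wpM2r ?mulr_ge0 ?exprn_ge0 ?(ltW v0) ?(ltW g0)// ler_wpM2l//.
by rewrite geometric_sum_le// ltW.
Unshelve. all: by end_near. Qed.

(** The coefficients are nonnegative, so the difference is at least its term [i = j = 1], which is
    [w ^ 2 - v ^ 2] as [rho 0 = 1]. This bound does not depend on [n], so the inequality stays
    strict in the limit. *)
Lemma stationary_variance_lt v w : 0 < v -> v < w -> w < 1 ->
  stationary_variance rho v < stationary_variance rho w.
Proof.
move=> v0 vw w1; have w0 := lt_trans v0 vw; have v1 := lt_trans vw w1.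
have vw2 : v ^+ 2 < w ^+ 2 by rewrite ltr_pXn2r// nnegrE ltW.
rewrite -subr_gt0; apply: (@lt_le_trans _ _ (w ^+ 2 - v ^+ 2)).
  by rewrite subr_gt0.
apply: (ler_cvg_to (cvg_cst _)
  (cvgB (truncated_variance_cvg w w0 w1) (truncated_variance_cvg v v0 v1))).
near=> n; have n1 : (1 < n)%N by near: n; exact: nbhs_infty_gt.
have le i j : 0 <= w ^+ (i + j)%N * rho (i%:Z - j%:Z) -
    v ^+ (i + j)%N * rho (i%:Z - j%:Z).
  by rewrite -mulrBl mulr_ge0// subr_ge0 lerXn2r ?nnegrE// ltW.
change (w ^+ 2 - v ^+ 2 <= truncated_variance n w - truncated_variance n v).
rewrite /truncated_variance -sumrB (bigD1 (Ordinal n1))//= -sumrB.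
rewrite (bigD1 (Ordinal n1))//= subrr rho0 !mulr1 -addrA lerDl addr_ge0//.
  by apply: sumr_ge0 => i _; exact: le.
by apply: sumr_ge0 => i _; rewrite -sumrB; apply: sumr_ge0 => j _; exact: le.
Unshelve. all: by end_near. Qed.

(** The increments [w ^ (i + j) - v ^ (i + j)] are nonnegative, so raising all coefficients to [C]
    can only increase the sum, and it turns the series into explicit geometric ones. *)
Lemma stationary_variance_sub_le v w : 0 < v -> v <= w -> w < 1 ->
  stationary_variance rho w - stationary_variance rho v <=
  C * (1 - w)^-1 ^+ 2 - C * (1 - v)^-1 ^+ 2.
Proof.
move=> v0 vw w1; have w0 := lt_le_trans v0 vw; have v1 := le_lt_trans vw w1.
have gc x : 0 < x -> x < 1 -> C * (\sum_(i < n) x ^+ i) ^+ 2 @[n --> \oo] -->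
    C * (1 - x)^-1 ^+ 2.
  move=> x0 x1; apply: cvgMl_tmp; rewrite expr2; under eq_fun do rewrite expr2.
  by apply: cvgM; apply: geometric_sum_cvg => //; exact: ltW.
apply: (ler_cvg_to
  (cvgB (truncated_variance_cvg w w0 w1) (truncated_variance_cvg v v0 v1))
  (cvgB (gc w w0 w1) (gc v v0 v1))).
apply: nearW => n.
change (truncated_variance n w - truncated_variance n v <=
  C * (\sum_(i < n) w ^+ i) ^+ 2 - C * (\sum_(i < n) v ^+ i) ^+ 2).
have sq x : C * (\sum_(i < n) x ^+ i) ^+ 2 = \sum_(i < n) \sum_(j < n) x ^+ (i + j)%N * C.
  rewrite expr2 mulr_suml mulr_sumr; apply: eq_bigr => i _.
  rewrite mulr_sumr mulr_sumr; apply: eq_bigr => j _.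
  by rewrite exprD mulrC.
rewrite !sq /truncated_variance -!sumrB; apply: ler_sum => i _.
rewrite -!sumrB; apply: ler_sum => j _; rewrite -!mulrBl ler_wpM2l//.
by rewrite subr_ge0 lerXn2r ?nnegrE// ltW.
Qed.

(** Increments are squeezed between zero and those of the continuous function [C / (1 - x) ^ 2]. *)
Lemma stationary_variance_continuous v : 0 < v -> v < 1 ->
  {for v, continuous (stationary_variance rho)}.
Proof.
move=> v0 v1; pose h x := C * (1 - x)^-1 ^+ 2.
have hc : h x @[x --> v] --> h v.
  apply: cvgMl_tmp; rewrite /h expr2; under eq_fun do rewrite expr2.
  by apply: cvgM; apply: cvgV; rewrite ?subr_eq0 ?gt_eqF//;
    apply: cvgB; [exact: cvg_cst|exact: cvg_id|exact: cvg_cst|exact: cvg_id].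
apply/cvgrPdist_lt => e e0; near=> x.
have x0 : 0 < x by near: x; exact: lt_nbhsr.
have x1 : x < 1 by near: x; exact: lt_nbhsl.
have : `|h v - h x| < e by near: x; exact: cvgr_dist_lt.
apply: le_lt_trans.
have mono y z : 0 < y -> y <= z -> z < 1 ->
    stationary_variance rho y <= stationary_variance rho z.
  move=> y0; rewrite le_eqVlt => /predU1P[->//|yz z1].
  by rewrite ltW// stationary_variance_lt.
have [vx|/ltW xv] := leP v x.
  have := stationary_variance_sub_le v x v0 vx x1; have := mono v x v0 vx x1.
  rewrite -/(h x) -/(h v) => m1 m2.
  by rewrite distrC (distrC (h v)) !ger0_norm// subr_ge0; lra.
have := stationary_variance_sub_le x v x0 xv v1; have := mono x v x0 xv v1.
rewrite -/(h x) -/(h v) => m1 m2.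
by rewrite !ger0_norm// subr_ge0; lra.
Unshelve. all: by end_near. Qed.

End variance_function.

(** For [y < x < z] near [x], eventually [f y < u n < f z]. The intermediate value theorem writes
    [u n] as [f w] with [w] between [y] and [z], and injectivity makes the partial inverse return
    this [w] instead of a value of [dflt]. *)
Lemma pinv_itvoo_cvg {R : realType} (dflt f : R -> R) (u : nat -> R) (a b x : R) :
  (forall y z, a < y -> y < z -> z < b -> f y < f z) ->
  (forall y, a < y -> y < b -> {for y, continuous f}) ->
  a < x -> x < b -> u n @[n --> \oo] --> f x ->
  'pinv_dflt `]a, b[%classic f (u n) @[n --> \oo] --> x.
Proof.
move=> f_lt f_cont ax xb uf.
have f_inj : {in `]a, b[%classic &, injective f}.
  move=> y z; rewrite !inE/= !in_itv/= => /andP[ay yb] /andP[az zb] fyz.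
  have [yz|zy|//] := ltgtP y z.
    by have := f_lt y z ay yz zb; rewrite fyz ltxx.
  by have := f_lt z y az zy yb; rewrite fyz ltxx.
apply/cvgrPdist_lt => e e0.
(* The midpoints keep [y] and [z] inside the interval, and [e / 2] keeps them strictly within [e] of
   [x]. *)
pose y := Num.max ((a + x) / 2) (x - e / 2).
pose z := Num.min ((x + b) / 2) (x + e / 2).
have ay : a < y by rewrite lt_max; apply/orP; left; lra.
have yx : y < x by rewrite gt_max; apply/andP; split; lra.
have xz : x < z by rewrite lt_min; apply/andP; split; lra.
have zb : z < b by rewrite gt_min; apply/orP; left; lra.
have ye : x - e < y by rewrite lt_max; apply/orP; right; lra.
have ze : z < x + e by rewrite gt_min; apply/orP; right; lra.
near=> n.
have fyu : f y < u n.
  by near: n; apply: (cvgr_gt _ uf); exact: f_lt.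
have ufz : u n < f z.
  by near: n; apply: (cvgr_lt _ uf); exact: f_lt.
have yz := ltW (lt_trans yx xz).
have fc : {within `[y, z], continuous f}.
  apply: continuous_in_subspaceT => t; rewrite inE/= in_itv/= => /andP[yt tz].
  by apply: f_cont; [exact: (lt_le_trans ay yt)|exact: (le_lt_trans tz zb)].
have uyz : Num.min (f y) (f z) <= u n <= Num.max (f y) (f z).
  by rewrite ge_min le_max (ltW fyu) (ltW ufz) orbT.
have [w] := IVT yz fc uyz.
rewrite in_itv/= => /andP[yw wz] <-.
rewrite pinvKV//; last first.
  by rewrite inE/= in_itv/= (lt_le_trans ay yw) (le_lt_trans wz zb).
by rewrite ltr_norml; apply/andP; split; lra.
Unshelve. all: by end_near. Qed.

(** * Almost sure convergence *)

(** By monotone convergence the series of the [D n] has integral at most [K], so it is finite almost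
    everywhere and its terms tend to zero. This takes the place of Chebyshev's inequality and the
    Borel-Cantelli lemma. *)
Lemma ae_cvg0_summable {d : measure_display} {T : measurableType d} {R : realType}
    (P : probability T R) (D : nat -> T -> R) (v : nat -> R) (K : R) :
  (forall n w, 0 <= D n w) -> (forall n, has_integral P (D n) (v n)) ->
  (forall n, \sum_(i < n) v i <= K) ->
  {ae P, forall w, D n w @[n --> \oo] --> 0}.
Proof.
move=> D0 Dv vK; pose S w := (\sum_(0 <= n <oo) (D n w)%:E)%E.
have mD n : measurable_fun setT (EFin \o D n) := measurable_int _ (Dv n).1.
have SI : (\int[P]_w S w <= K%:E)%E.
  rewrite integral_nneseries//; last by move=> n w _; rewrite lee_fin.
  apply: lime_le.
    by apply: is_cvg_nneseries => n _ _; apply: integral_ge0 => w _; rewrite lee_fin.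
  apply: nearW => n; rewrite (eq_bigr (fun i => (v i)%:E)) => [|i _];
    last exact: (Dv i).2.
  by rewrite sumEFin lee_fin big_mkord.
have S0 w : (0 <= S w)%E by apply: nneseries_ge0 => n _ _; rewrite lee_fin.
have Si : P.-integrable setT S.
  apply/integrableP; split.
    by apply: ge0_emeasurable_sum => [n w _ _|n _]; [rewrite lee_fin|exact: mD].
  under eq_integral do rewrite gee0_abs//.
  exact: le_lt_trans SI (ltry _).
apply: filterS (integrable_ae measurableT Si) => w /(_ I) Sw.
apply: cvg_series_cvg_0; apply: nondecreasing_is_cvgn.
  by apply/nondecreasing_seqP => n; rewrite /series/= big_nat_recr//= lerDl.
exists (fine (S w)) => _ [n _ <-]; rewrite /series/= -lee_fin fineK// -sumEFin.
by apply: nneseries_lim_ge => i _ _; rewrite lee_fin.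
Qed.

(** * Covariances of the autoregression *)

Section ar1_moments.
Context {d : measure_display} {T : measurableType d} {R : realType}.
Variables (P : probability T R) (xi : int -> {RV P >-> R}) (theta : R).
Hypotheses (theta_gt0 : 0 < theta) (theta_lt1 : theta < 1)
  (xi_gaussian : gaussian_sequence xi) (xi_centered : centered_sequence xi)
  (xi_stationary : stationary_sequence xi).
Local Notation X := (ar1 xi theta).
Local Notation rho := (autocovariance xi).

Lemma ar1E t w : X t w = \sum_(i < t) theta ^+ i * xi (t%:Z - i%:Z) w.
Proof.
elim: t => [|t IH] /=; first by rewrite big_ord0.
rewrite IH big_ord_recl/= expr0 mul1r subr0 addrC mulr_sumr; congr (_ + _).
apply: eq_bigr => i _; rewrite mulrA -exprS; congr (_ * xi _ w).
by rewrite /bump/= add1n; lia.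
Qed.

Lemma in_span_ar1 t : in_span P xi (X t).
Proof.
elim: t => [|t IH]; first exact: in_span0.
exact: (in_spanD _ _ _ _ (in_spanZ _ _ theta _ IH) (in_span_gen _ _ t.+1%:Z)).
Qed.

Lemma ip_ar1_diag t : ip P (X t) (X t) =
  \sum_(i < t) \sum_(j < t) theta ^+ (i + j)%N * rho (j%:Z - i%:Z).
Proof.
apply: has_integral_ipP.
have h (i j : 'I_t) : has_integral P
    (fun w => theta ^+ (i + j)%N * (xi (t%:Z - i%:Z) w * xi (t%:Z - j%:Z) w))
    (theta ^+ (i + j)%N * rho (j%:Z - i%:Z)).
  apply: has_integralZ; have -> : j%:Z - i%:Z = (t%:Z - i%:Z) - (t%:Z - j%:Z) by lia.
  by rewrite -ip_gen//; apply: has_integral_ip => //; exact: in_span_gen.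
have := has_integral_sum P _ (index_enum 'I_t) _ _ (fun i : 'I_t =>
  has_integral_sum P _ (index_enum 'I_t) _ _ (fun j : 'I_t => h i j)).
congr has_integral; apply/funext => w; rewrite !ar1E mulr_suml.
apply: eq_bigr => i _; rewrite mulr_sumr; apply: eq_bigr => j _.
by rewrite exprD; ring.
Qed.

(** Bilinearity carries the recursion of [X] over to each argument of [ip] in turn, which is the
    setting of [ar_kernel_sum_sqr]. *)
Lemma sum_ip_ar1_sqr (C : R) n : (forall k, 0 <= rho k <= C) ->
  \sum_(s < n) \sum_(t < n) ip P (X s.+1) (X t.+1) ^+ 2 <=
  C / (1 - theta) ^+ 4 * \sum_(s < n) \sum_(t < n) rho (s%:Z - t%:Z).
Proof.
move=> rhoC; have C0 : 0 <= C by have /andP[h1 h2] := rhoC 0; exact: le_trans h1 h2.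
have sX := in_span_ar1; have sxi i := in_span_gen P xi i.
have ip0 f : in_span P xi f -> ip P (X 0) f = 0.
  move=> sf; apply: has_integral_ipP; under eq_fun do rewrite /= mul0r.
  exact: has_integral0.
have ipS s f : in_span P xi f ->
    ip P (X s.+1) f = theta * ip P (X s) f + ip P (xi s.+1%:Z) f.
  by move=> sf; exact: ip_linear.
have h := @ar_kernel_sum_sqr _ theta C (fun s t => ip P (X s) (X t))
  (fun s t => ip P (xi s%:Z) (X t)) (fun s t => ip P (xi s%:Z) (xi t%:Z)) n.
apply: (le_trans (h _ _ _ _ _ _ _ _)) => //.
- exact: ltW.
- by move=> t; exact: ip0.
- by move=> s t; exact: ipS.
- by move=> s; rewrite ipC; exact: ip0.
- by move=> s t; rewrite ipC ipS// ipC (ipC P _ (xi s%:Z)).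
- by move=> s t; rewrite ip_gen.
(* Both indices are shifted by one, which leaves their difference unchanged. *)
rewrite le_eqVlt; apply/orP; left; apply/eqP; congr (_ * _).
apply: eq_bigr => s _; apply: eq_bigr => t _; rewrite ip_gen//; congr autocovariance.
by lia.
Qed.

End ar1_moments.

(** * Almost sure convergence of the empirical second moment *)

Section consistency.
Context {d : measure_display} {T : measurableType d} {R : realType}.
Variables (P : probability T R) (xi : int -> {RV P >-> R}) (theta : R).
Hypotheses (theta_gt0 : 0 < theta) (theta_lt1 : theta < 1)
  (xi_gaussian : gaussian_sequence xi) (xi_centered : centered_sequence xi)
  (xi_stationary : stationary_sequence xi).
Variables (k : nat -> R) (C : R) (q : nat).
Local Notation X := (ar1 xi theta).
Local Notation rho := (autocovariance xi).
Hypotheses (rhoE : forall z, rho z = k `|z|%N) (k0 : k 0 = 1)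
  (kC : forall i, 0 <= k i <= C) (q2 : (2 <= q)%N)
  (kd : forall N i, (N.+1 ^ q <= i)%N -> k i <= C / N.+1%:R ^+ 2).

Let U n w := \sum_(t < n) X t.+1 w ^+ 2.
Let Q n := \sum_(t < n) ip P (X t.+1) (X t.+1).
(** [N.+1] keeps [p N] positive, and the exponent [2 * q] lets covariance sums be split at the
    square root [N.+1 ^ q]. *)
Let p N := (N.+1 ^ (2 * q))%N.

(** The squared deviations have integrals [O((N + 1)^-2)], which are summable. *)
Lemma second_moment_powers_ae :
  {ae P, forall w, (p N)%:R^-1 * U (p N) w - (p N)%:R^-1 * Q (p N) @[N --> \oo] --> 0}.
Proof.
pose D N w := ((p N)%:R^-1) ^+ 2 * (U (p N) w - Q (p N)) ^+ 2.
pose v N := ((p N)%:R^-1) ^+ 2 *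
  (2 * \sum_(s < p N) \sum_(t < p N) ip P (X s.+1) (X t.+1) ^+ 2).
(* The [8] collects a factor [2] each from Isserlis' formula, from the two sides of the diagonal and
   from the split of the covariance sum; one [C] bounds the covariances of [X], the other comes from
   that split. *)
pose B := 8 * C ^+ 2 / (1 - theta) ^+ 4.
have C0 : 0 <= C by have /andP[h1 h2] := kC 0; exact: le_trans h1 h2.
have t4 : 0 < (1 - theta) ^+ 4 by rewrite exprn_gt0// subr_gt0.
have B0 : 0 <= B by rewrite divr_ge0 ?(ltW t4)// mulr_ge0// exprn_ge0.
have vB N : v N <= B * (N.+1%:R ^+ 2)^-1.
  have p0 : 0 < (p N)%:R :> R by rewrite ltr0n expn_gt0.
  have h1 := sum_ip_ar1_sqr P xi theta theta_gt0 theta_lt1 xi_gaussian xi_centered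
    xi_stationary C (p N) (fun z => ltac:(rewrite rhoE; exact: kC)).
  have h2 : \sum_(s < p N) \sum_(t < p N) rho (s%:Z - t%:Z) <=
      2 * (p N)%:R * \sum_(i < p N) k i.
    have := sum_dist_le k (p N) (fun i => (andP (kC i)).1).
    apply: le_trans; rewrite le_eqVlt; apply/orP; left; apply/eqP.
    by apply: eq_bigr => s _; apply: eq_bigr => t _; rewrite rhoE.
  have h3 := sum_powers_le k C q N q2 kC (kd N).
  have Ct : 0 <= C / (1 - theta) ^+ 4 by rewrite divr_ge0// ltW.
  have N0 : 0 < N.+1%:R ^+ 2 :> R by rewrite exprn_gt0// ltr0n.
  have p20 : 0 <= 2 * (p N)%:R :> R by rewrite mulr_ge0// ltW.
  have h4 := le_trans h1 (ler_wpM2l Ct (le_trans h2 (ler_wpM2l p20 h3))).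
  rewrite /v exprVn mulrC ler_pdivrMr ?exprn_gt0//.
  apply: (le_trans (ler_wpM2l (ler0n _ 2) h4)).
  rewrite le_eqVlt; apply/orP; left; apply/eqP; rewrite /B -/(p N).
  have pn : (p N)%:R != 0 :> R by rewrite gt_eqF.
  have Nn : N.+1%:R != 0 :> R by rewrite pnatr_eq0.
  have tn : 1 - theta != 0 by rewrite subr_eq0 gt_eqF.
  move: (N.+1%:R) Nn => b bn.
  by field; rewrite bn tn.
have vK n : \sum_(i < n) v i <= B * 2.
  apply: (le_trans (ler_sum _ (fun (i : 'I_n) _ => vB i))).
  by rewrite -mulr_sumr ler_wpM2l// sum_inv_sqr_le.
have D0 N w : 0 <= D N w by rewrite mulr_ge0// exprn_even_ge0.
have Dv N : has_integral P (D N) (v N).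
  apply: has_integralZ;
    apply: (has_integral_variance_sum_sqr P xi _ _ (p N) (fun t => X t.+1)) => //.
  by move=> t; exact: in_span_ar1.
apply: filterS (ae_cvg0_summable P D v _ D0 Dv vK) => w Dw.
apply: norm_cvg0.
have : Num.sqrt (D N w) @[N --> \oo] --> Num.sqrt (0 : R).
  by apply: (@cvg_comp _ _ _ _ Num.sqrt _ _ _ Dw); exact: sqrt_continuous.
rewrite sqrtr0; suff -> : (fun N => Num.sqrt (D N w)) =
  (fun N => `|(p N)%:R^-1 * U (p N) w - (p N)%:R^-1 * Q (p N)|) by [].
by apply/funext => N; rewrite /D -exprMn sqrtr_sqr mulrBr.
Qed.

(** [Q n / n] is the Cesaro mean of the variances at the times [1, ..., n], which tend to the
    stationary variance. This gives the limit along [p N], and [cvg_mean_powers] extends it to all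
    [n] as [U] is nondecreasing. *)
Lemma second_moment_cvg_ae :
  {ae P, forall w, second_moment xi theta n w @[n --> \oo] -->
     stationary_variance rho theta}.
Proof.
have rho_ge0 z : 0 <= rho z by rewrite rhoE; case/andP: (kC `|z|%N).
have rho_le z : rho z <= C by rewrite rhoE; case/andP: (kC `|z|%N).
have tv := truncated_variance_cvg rho C rho_ge0 rho_le theta theta_gt0 theta_lt1.
have qE t : ip P (X t) (X t) = truncated_variance rho t theta.
  rewrite ip_ar1_diag//; apply: eq_bigr => i _; apply: eq_bigr => j _.
  by rewrite !rhoE distnC.
have Qc : n%:R^-1 * Q n @[n --> \oo] --> stationary_variance rho theta.
  rewrite -(cvg_shiftS (fun n => n%:R^-1 * Q n)).
  have := @cesaro R (fun t => truncated_variance rho t.+1 theta)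
    (stationary_variance rho theta).
  rewrite (cvg_shiftS (fun n => truncated_variance rho n theta)) => /(_ tv).
  suff -> : arithmetic_mean (fun t => truncated_variance rho t.+1 theta) =
    (fun n => n.+1%:R^-1 * Q n.+1) by [].
  apply/funext => n; rewrite /arithmetic_mean/= /series/= big_mkord; congr (_ * _).
  by apply: eq_bigr => i _; rewrite -qE.
have pc : p N @[N --> \oo] --> \oo.
  apply/cvgnyPge => K; near=> N.
  have KN : (K <= N)%N by near: N; exact: nbhs_infty_ge.
  apply: (leq_trans KN); apply: (leq_trans (leqnSn N)).
  by rewrite -[X in (X <= _)%N]expn1 leq_pexp2l// muln_gt0/= (leq_trans _ q2).
have Qp : (p N)%:R^-1 * Q (p N) @[N --> \oo] --> stationary_variance rho theta.
  exact: (@cvg_comp _ _ _ p (fun n => n%:R^-1 * Q n) _ _ _ pc Qc).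
apply: filterS second_moment_powers_ae => w h.
have Up : (p N)%:R^-1 * U (p N) w @[N --> \oo] --> stationary_variance rho theta.
  have : ((p N)%:R^-1 * U (p N) w - (p N)%:R^-1 * Q (p N)) + (p N)%:R^-1 * Q (p N)
      @[N --> \oo] --> 0 + stationary_variance rho theta by exact: cvgD h Qp.
  by rewrite add0r; under eq_fun do rewrite subrK.
have m0 : (0 < 2 * q)%N by rewrite muln_gt0/= (leq_trans _ q2).
have := @cvg_mean_powers R (2 * q)%N (U ^~ w) _ m0 _ _ _.
move=> /(_ (stationary_variance rho theta)).
have -> : (fun n => n%:R^-1 * U n w) = (fun n => second_moment xi theta n w).
  by apply/funext => n; rewrite /second_moment big_add1/= big_mkord.
apply.
- apply/nondecreasing_seqP => n; rewrite /U big_ord_recr/= lerDl.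
  exact: sqr_ge0.
- by move=> n; apply: sumr_ge0 => i _; exact: sqr_ge0.
- by rewrite -(cvg_shiftS (fun N => ((N ^ (2 * q))%:R)^-1 * U (N ^ (2 * q))%N w)).
Unshelve. all: by end_near. Qed.

End consistency.

(** * Strong consistency of the second moment estimator *)

Theorem theorem1p2 (d : measure_display) (T : measurableType d) (R : realType)
    (P : probability T R) (H theta : R) (xi : int -> {RV P >-> R})
    (L : R -> R) (dflt : R -> R)
    (H_gt : 1 / 2 < H) (H_lt : H < 1)
    (theta_gt0 : 0 < theta) (theta_lt1 : theta < 1)
    (xi_gaussian : gaussian_sequence xi)
    (xi_centered : centered_sequence xi)
    (xi_stationary : stationary_sequence xi)
    (L_gt0 : forall x : R, 0 < x -> 0 < L x)
    (L_slow : zygmund_slowly_varying L)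
    (L_BV : forall a : R, 0 < a ->
      bounded_variation_oo a pi (fun lambda : R => L (1 / lambda)))
    (rho0 : autocovariance xi 0 = 1)
    (rhoE : forall k : int, k != 0 ->
      autocovariance xi k
      = L (absz k)%:R * ((absz k)%:R : R) `^ (2 * H - 2)) :
  {ae P, forall w,
    second_moment_estimator dflt xi theta n w @[n --> \oo] --> theta}.
Proof.
pose k i := autocovariance xi i%:Z.
have kE i : (0 < i)%N -> k i = L i%:R * i%:R `^ (2 * H - 2).
  by move=> i0; rewrite /k rhoE// eqz_nat -lt0n.
have rhok z : autocovariance xi z = k `|z|%N.
  have [->//|z0] := eqVneq z 0.
  by rewrite rhoE// kE// absz_gt0.
have k_ge0 i : 0 <= k i.
  case: i => [|i]; first by rewrite /k rho0.
  by rewrite kE// mulr_ge0 ?powR_ge0// ltW// L_gt0// ltr0n.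
have [C0 C00 hC0] := slowly_varying_decay H L k H_lt L_slow k_ge0 kE.
have a0 : 0 < 1 - H by rewrite subr_gt0.
have [q q2 hq] := powR_decay (1 - H) a0.
(* [C0] controls only positive lags; the summand [1] makes [C] bound [k 0 = 1] too. *)
pose C := C0 + 1; have C0C : C0 <= C by rewrite lerDl.
have kC i : 0 <= k i <= C.
  rewrite k_ge0/=; case: i => [|i]; first by rewrite /k rho0 lerDr.
  apply: (le_trans (hC0 i.+1 isT)); apply: le_trans C0C; rewrite ler_piMr//.
  (* The case [N = 0] of the decay estimate bounds the power of the lag by [1]. *)
  by apply: (le_trans (hq 0%N i.+1 _)); rewrite ?exp1n// expr1n invr1.
have kd N i : (N.+1 ^ q <= i)%N -> k i <= C / N.+1%:R ^+ 2.
  move=> Ni; have i0 : (0 < i)%N by apply: leq_trans Ni; rewrite expn_gt0.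
  by apply: (le_trans (hC0 _ i0)); rewrite ler_pM ?powR_ge0// hq.
have rho_ge0 z : 0 <= autocovariance xi z by rewrite rhok.
have rho_le z : autocovariance xi z <= C by rewrite rhok; case/andP: (kC `|z|%N).
have := second_moment_cvg_ae P xi theta theta_gt0 theta_lt1 xi_gaussian
  xi_centered xi_stationary k C q rhok kC q2 kd.
(* On every path where the empirical second moment converges, the inverse passes to the limit, as
   the stationary variance is continuous and strictly increasing. *)
apply: filterS => w Sw; apply: pinv_itvoo_cvg => //.
- by move=> y z; exact: stationary_variance_lt.
- by move=> y; exact: stationary_variance_continuous.
Qed.
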